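(* Let $\phi$ be a partial flow on a metric space $X$. Every isolated set $\Lambda$ of $\phi$ admits a catenary pseudo-metric. If $\Lambda$ is a singleton, it admits a catenary metric.
   Context: A partial flow on a metric space $X$ is a continuous map $\phi\colon\Gamma\to X$ on an open set $\Gamma\subset\mathbb{R}\times X$. Here $\Gamma_x=\{t:(t,x)\in\Gamma\}$ is a connected set containing $0$, $\Gamma_{\phi_t(x)}=\Gamma_x-t$, $\phi_0=\mathrm{id}$, and $\phi_s\phi_t=\phi_{s+t}$ where defined. A $\phi$-invariant set $\Lambda$ is isolated if there is a compact neighborhood $N$ (an isolating neighborhood) such that $\phi_{\Gamma_x}(x)\subseteq N$ implies $x\in\Lambda$. For a function $F$ on $N\times N$, $\dot F(x,y)=\frac{d}{dt}\big|_{t=0}F(\phi_t(x),\phi_t(y))$ and $\ddot F=(\dot F)^{\cdot}$. A catenary pseudo-metric for $\Lambda$ is a continuous pseudo-metric $\mathrm d\colon N\times N\to\mathbb{R}$ on an isolating neighborhood $N$ of $\Lambda$ such that $\ddot{\mathrm d}=\mathrm d$, and $\mathrm d(x,y)=0$ if and only if $x=y$ or $x,y\in\Lambda$. If in addition $\mathrm d(x,y)=0$ implies $x=y$, it is a catenary metric. *)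

(* Defs.v *)
From Stdlib Require Import Reals List.
Open Scope R_scope.

Definition is_metric {X : Type} (dist : X -> X -> R) : Prop :=
  (forall x y, dist x y = 0 <-> x = y) /\
  (forall x y, dist x y = dist y x) /\
  (forall x y z, dist x z <= dist x y + dist y z).

Definition open_in {X : Type} (dist : X -> X -> R) (U : X -> Prop) : Prop :=
  forall x, U x -> exists r, 0 < r /\ forall y, dist x y < r -> U y.

Definition open_RX {X : Type} (dist : X -> X -> R) (G : R -> X -> Prop) : Prop :=
  forall t x, G t x -> exists r, 0 < r /\
    forall s y, Rabs (s - t) < r -> dist x y < r -> G s y.

Definition open_R (U : R -> Prop) : Prop :=
  forall t, U t -> exists r, 0 < r /\ forall s, Rabs (s - t) < r -> U s.

Definition connected_R (S : R -> Prop) : Prop :=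
  forall U V : R -> Prop, open_R U -> open_R V ->
    (forall t, S t -> U t \/ V t) ->
    (forall t, ~ (S t /\ U t /\ V t)) ->
    (forall t, ~ (S t /\ U t)) \/ (forall t, ~ (S t /\ V t)).

Definition compact_in {X : Type} (dist : X -> X -> R) (N : X -> Prop) : Prop :=
  forall (I : Type) (U : I -> X -> Prop),
    (forall i, open_in dist (U i)) ->
    (forall x, N x -> exists i, U i x) ->
    exists l : list I, forall x, N x -> exists i, In i l /\ U i x.

Definition nbhd_of {X : Type} (dist : X -> X -> R) (N L : X -> Prop) : Prop :=
  forall x, L x -> exists r, 0 < r /\ forall y, dist x y < r -> N y.

(* phi is meaningful only on the domain G (G t x  <->  (t,x) in Gamma). *)
Definition partial_flow {X : Type} (dist : X -> X -> R)
  (phi : R -> X -> X) (G : R -> X -> Prop) : Prop :=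
  open_RX dist G /\
  (forall t x, G t x -> forall eps, 0 < eps -> exists del, 0 < del /\
     forall s y, G s y -> Rabs (s - t) < del -> dist x y < del ->
       dist (phi s y) (phi t x) < eps) /\
  (forall x, G 0 x) /\
  (forall x, connected_R (fun t => G t x)) /\
  (forall x t s, G t x -> (G s (phi t x) <-> G (s + t) x)) /\
  (forall x, phi 0 x = x) /\
  (forall x t s, G t x -> G s (phi t x) -> phi s (phi t x) = phi (s + t) x).

Definition invariant {X : Type} (phi : R -> X -> X) (G : R -> X -> Prop)
  (L : X -> Prop) : Prop :=
  forall x, L x -> forall t, G t x -> L (phi t x).

Definition isolating_nbhd {X : Type} (dist : X -> X -> R)
  (phi : R -> X -> X) (G : R -> X -> Prop) (L N : X -> Prop) : Prop :=
  compact_in dist N /\ nbhd_of dist N L /\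
  (forall x, (forall t, G t x -> N (phi t x)) -> L x).

Definition isolated {X : Type} (dist : X -> X -> R)
  (phi : R -> X -> X) (G : R -> X -> Prop) (L : X -> Prop) : Prop :=
  invariant phi G L /\ exists N, isolating_nbhd dist phi G L N.

Definition pseudo_metric_on {X : Type} (N : X -> Prop) (d : X -> X -> R) : Prop :=
  (forall x, N x -> d x x = 0) /\
  (forall x y, N x -> N y -> 0 <= d x y) /\
  (forall x y, N x -> N y -> d x y = d y x) /\
  (forall x y z, N x -> N y -> N z -> d x z <= d x y + d y z).

Definition continuous_on_NN {X : Type} (dist : X -> X -> R) (N : X -> Prop)
  (d : X -> X -> R) : Prop :=
  forall x y, N x -> N y -> forall eps, 0 < eps -> exists del, 0 < del /\
    forall x' y', N x' -> N y' -> dist x x' < del -> dist y y' < del ->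
      Rabs (d x' y' - d x y) < eps.

Definition flow_deriv {X : Type} (phi : R -> X -> X) (G : R -> X -> Prop)
  (N : X -> Prop) (F : X -> X -> R) (x y : X) (l : R) : Prop :=
  forall eps, 0 < eps -> exists del, 0 < del /\
    forall t, t <> 0 -> Rabs t < del -> G t x -> G t y ->
      N (phi t x) -> N (phi t y) ->
      Rabs ((F (phi t x) (phi t y) - F x y) / t - l) < eps.

Definition ddot_eq_self {X : Type} (phi : R -> X -> X) (G : R -> X -> Prop)
  (N : X -> Prop) (d : X -> X -> R) : Prop :=
  exists dd : X -> X -> R,
    forall x y, N x -> N y ->
      flow_deriv phi G N d x y (dd x y) /\ flow_deriv phi G N dd x y (d x y).

Definition catenary_pseudo_metric {X : Type} (dist : X -> X -> R)
  (phi : R -> X -> X) (G : R -> X -> Prop) (L N : X -> Prop)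
  (d : X -> X -> R) : Prop :=
  isolating_nbhd dist phi G L N /\
  pseudo_metric_on N d /\
  continuous_on_NN dist N d /\
  ddot_eq_self phi G N d /\
  (forall x y, N x -> N y -> (d x y = 0 <-> (x = y \/ (L x /\ L y)))).

Definition catenary_metric {X : Type} (dist : X -> X -> R)
  (phi : R -> X -> X) (G : R -> X -> Prop) (L N : X -> Prop)
  (d : X -> X -> R) : Prop :=
  catenary_pseudo_metric dist phi G L N d /\
  (forall x y, N x -> N y -> d x y = 0 -> x = y).

(* Main.v *)
(* The pseudo-metric is a sum [du + ds], where along short orbit pieces near [L] the
   unstable part [du] is multiplied by [exp t] and the stable part [ds], which is the
   unstable part of the reversed flow, by [exp (- t)].

   Let [K] be the distance to [L], truncated so that [K < 4 * a] forces a point into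
   the given isolating neighborhood, and work on [K <= a]. If [g] is a Lipschitz
   function of a point [z] and of the running maximum [m] of [K] along the orbit, and
   [g] vanishes for [m <= 2 * a] and for [m >= 4 * a], then the supremum over [s >= 0] of
   [exp (- s) * g] is a function [f] with [f (phi t x) = exp t * f x]. It is continuous,
   although the exit time is not: an orbit contributes nothing after it has left the
   neighborhood, and times beyond [S] contribute at most a multiple of [exp (- S)].
   The unstable part is the supremum of [|f x - f y|] over a family of such [g].

   If [x] is not in [L], its orbit leaves the neighborhood, say forward. Functions [g]
   concentrated near [m = 3 * a] and near the point where the orbit first reaches
   [K = 3 * a] recover this point and the hitting time, hence also [x]. *)
Require Import Defs.
From Stdlib Require Import Reals List Lra Classical ClassicalEpsilon.
Open Scope R_scope.

(** * Suprema of sets of reals *)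

(** Choosing a least upper bound by [epsilon] makes the supremum a total function; its value is
    meaningful only for nonempty sets that are bounded above. *)
Definition Rsup (E : R -> Prop) : R := epsilon (inhabits 0) (is_lub E).

Lemma Rsup_is_lub (E : R -> Prop) (M : R) :
  (exists v, E v) -> (forall w, E w -> w <= M) -> is_lub E (Rsup E).
Proof.
intros Hex Hb.
apply (epsilon_spec (inhabits 0) (is_lub E)).
destruct (completeness E) as [m Hm]; [now exists M | exact Hex | now exists m].
Qed.

Lemma Rsup_ub (E : R -> Prop) (M v : R) :
  (forall w, E w -> w <= M) -> E v -> v <= Rsup E.
Proof.
intros Hb Hv.
apply (Rsup_is_lub E M); [now exists v | exact Hb | exact Hv].
Qed.

Lemma Rsup_le (E : R -> Prop) (M : R) :
  (exists v, E v) -> (forall w, E w -> w <= M) -> Rsup E <= M.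
Proof.
intros Hex Hb.
now apply (Rsup_is_lub E M).
Qed.

Lemma Rabs_lt_iff (x y : R) : Rabs x < y <-> - y < x < y.
Proof.
split; [intros H; apply Rabs_def2 in H; lra | intros []; now apply Rabs_def1].
Qed.

(** * Uniform radii by compactness *)

(** Compactness of [[0, T]] as a supremum argument: [E] collects the [c] for which one radius serves
    on all of [[0, c]], and its supremum must be [T]. *)
Lemma interval_uniform (T : R) (P : R -> R -> Prop) :
  0 <= T ->
  (forall t r r', 0 < r' -> r' <= r -> P t r -> P t r') ->
  (forall t, 0 <= t <= T ->
     exists r, 0 < r /\ forall s, 0 <= s <= T -> Rabs (s - t) < r -> P s r) ->
  exists e, 0 < e /\ forall t, 0 <= t <= T -> P t e.
Proof.
intros HT anti loc.
set (E := fun c => 0 <= c <= T /\ exists e, 0 < e /\ forall t, 0 <= t <= c -> P t e).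
assert (E0 : E 0).
{ split; [lra|].
  destruct (loc 0) as [r [Hr Hl]]; [lra|].
  exists r; split; [exact Hr|].
  intros t Ht; apply Hl; [lra|].
  apply Rabs_lt_iff; lra. }
destruct (completeness E) as [c [cub cleast]].
{ exists T; intros x [Hx _]; lra. }
{ now exists 0. }
assert (Hc : 0 <= c <= T).
{ split; [now apply cub|]. apply cleast; intros x [Hx _]; lra. }
destruct (loc c Hc) as [r [Hr Hl]].
assert (Hnear : exists b, E b /\ c - r < b).
{ apply NNPP; intro Hn.
  assert (c <= c - r); [|lra].
  apply cleast; intros x Ex.
  apply Rnot_lt_le; intro Hx; apply Hn; now exists x. }
destruct Hnear as [b [[Hb [e [He Pe]]] Hbc]].
(* This point passes the supremum [c] unless it is cut off at [T]; as it lies in [E], it must equal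
   [T]. *)
set (b' := Rmin T (c + r / 2)).
assert (Hb' : b' <= T /\ b' <= c + r / 2) by (split; [apply Rmin_l | apply Rmin_r]).
assert (Eb' : E b').
{ assert (0 <= b') by (apply Rmin_glb; lra).
  split; [lra|].
  exists (Rmin e r); split; [now apply Rmin_glb_lt|].
  intros t Ht.
  destruct (Rle_lt_dec t b) as [Htb|Htb].
  - apply (anti t e); [now apply Rmin_glb_lt | apply Rmin_l | apply Pe; lra].
  - apply (anti t r); [now apply Rmin_glb_lt | apply Rmin_r |].
    apply Hl; [lra|]. apply Rabs_lt_iff; lra. }
assert (b' <= c) by now apply cub.
assert (b' = T).
{ unfold b' in *; destruct (Rle_dec T (c + r / 2)) as [h|h];
  [now rewrite Rmin_left | rewrite Rmin_right in *; lra]. }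
destruct Eb' as [_ [e' [He' Pe']]].
exists e'; split; [exact He'|].
intros t Ht; apply Pe'; lra.
Qed.

(** A Lebesgue number argument: finitely many balls with good radii cover [N], and the smallest of
    these radii serves everywhere since [P] passes to smaller radii. *)
Lemma compact_uniform {X : Type} (dist : X -> X -> R) (N : X -> Prop)
  (P : X -> R -> Prop) :
  is_metric dist -> compact_in dist N ->
  (forall x r r', 0 < r' -> r' <= r -> P x r -> P x r') ->
  (forall x, N x ->
     exists r, 0 < r /\ forall y, N y -> dist x y < r -> P y r) ->
  exists e, 0 < e /\ forall x, N x -> P x e.
Proof.
intros [dist0 [_ tri]] cN anti loc.
(* The cover is indexed by all pairs of centre and radius; a pair without the required property
   indexes the empty set. *)
destruct (cN (X * R)%type (fun c y => (0 < snd c /\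
    forall z, N z -> dist (fst c) z < snd c -> P z (snd c)) /\
    dist (fst c) y < snd c)) as [l Hl].
{ intros [x r] y [Hx Hy]; simpl in *.
  exists (r - dist x y); split; [lra|].
  intros z Hz; split; [exact Hx|].
  specialize (tri x y z); lra. }
{ intros x Nx.
  destruct (loc x Nx) as [r [Hr Hx]].
  exists (x, r); simpl; split; [now split|].
  rewrite (proj2 (dist0 x x) eq_refl); exact Hr. }
assert (He : exists e, 0 < e /\ forall c, In c l -> 0 < snd c -> e <= snd c).
{ clear Hl; induction l as [|c l [e [He IH]]].
  - exists 1; split; [lra | intros c []].
  - destruct (Rlt_dec 0 (snd c)) as [Hc|Hc].
    + exists (Rmin e (snd c)); split; [now apply Rmin_glb_lt|].
      intros c' [<-|Hin] Hc'; [apply Rmin_r|].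
      apply Rle_trans with e; [apply Rmin_l | now apply IH].
    + exists e; split; [exact He|].
      intros c' [<-|Hin] Hc'; [contradiction | now apply IH]. }
destruct He as [e [He Hmin]].
exists e; split; [exact He|].
intros x Nx.
destruct (Hl x Nx) as [c [Hin [[Hc HP] Hx]]].
apply (anti x (snd c)); auto.
Qed.

(** For [x] outside [N] the distance to [x] is locally bounded below on [N] by a positive number,
    hence uniformly so. *)
Lemma compact_closed {X : Type} (dist : X -> X -> R) (N : X -> Prop) (x : X) :
  is_metric dist -> compact_in dist N ->
  (forall e, 0 < e -> exists y, N y /\ dist x y < e) -> N x.
Proof.
intros Hd cN clos.
apply NNPP; intro Nx.
destruct (compact_uniform dist N (fun y r => r <= dist x y) Hd cN) as [e [He HN]].
- intros; lra.
- destruct Hd as [dist0 [dsym tri]].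
  intros y Ny.
  assert (Hpos : 0 < dist x y).
  { assert (dist x y <> 0) by (intro H; apply Nx; apply dist0 in H; now subst).
    assert (dist y y = 0) by now apply dist0.
    generalize (tri y x y) (dsym x y); lra. }
  exists (dist x y / 2); split; [lra|].
  intros z _ Hz.
  generalize (tri x z y) (dsym y z); lra.
- destruct (clos e He) as [y [Ny Hy]].
  specialize (HN y Ny); lra.
Qed.

Lemma compact_closed_subset {X : Type} (dist : X -> X -> R) (N A : X -> Prop) :
  compact_in dist N -> (forall x, A x -> N x) ->
  open_in dist (fun x => ~ A x) -> compact_in dist A.
Proof.
intros cN sub op I U opU cov.
(* [None] indexes the complement of [A], which completes a cover of [A] to one of [N]. *)
destruct (cN (option I) (fun i => match i with Some i => U i | None => fun x => ~ A x end))
  as [l Hl].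
- intros [i|]; auto.
- intros x _.
  destruct (classic (A x)) as [Ax|Ax]; [|now exists None].
  destruct (cov x Ax) as [i Hi]; now exists (Some i).
- exists (flat_map (fun o => match o with Some i => i :: nil | None => nil end) l).
  intros x Ax.
  destruct (Hl x (sub x Ax)) as [[i|] [Hin Hi]]; [|contradiction].
  exists i; split; [|exact Hi].
  apply in_flat_map; exists (Some i); split; [exact Hin | now left].
Qed.

(** * Time reversal and domains of partial flows *)

Lemma partial_flow_reverse {X : Type} (dist : X -> X -> R)
  (phi : R -> X -> X) (G : R -> X -> Prop) :
  partial_flow dist phi G ->
  partial_flow dist (fun t => phi (- t)) (fun t => G (- t)).
Proof.
intros (op & cont & G0 & conn & Gadd & phi0 & phiadd).
assert (opp : forall s t r, Rabs (s - t) < r -> Rabs (- s - - t) < r).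
{ intros s t r; replace (- s - - t) with (- (s - t)) by ring.
  now rewrite Rabs_Ropp. }
refine (conj _ (conj _ (conj _ (conj _ (conj _ (conj _ _)))))).
- intros t x Gt. destruct (op _ _ Gt) as [r [Hr H]].
  exists r; split; [exact Hr|]; intros; apply H; auto.
- intros t x Gt e He. destruct (cont _ _ Gt e He) as [r [Hr H]].
  exists r; split; [exact Hr|]; intros; apply H; auto.
- intro x; rewrite Ropp_0; apply G0.
- intros x U V oU oV cov disj.
  destruct (conn x (fun t => U (- t)) (fun t => V (- t))) as [H|H].
  + intros t Ut; destruct (oU _ Ut) as [r [Hr H]].
    exists r; split; auto.
  + intros t Vt; destruct (oV _ Vt) as [r [Hr H]].
    exists r; split; auto.
  + intros t Gt; apply cov; now rewrite Ropp_involutive.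
  + intros t Ht; apply (disj (- t)); now rewrite Ropp_involutive.
  + left; intros t Ht; apply (H (- t)); now rewrite Ropp_involutive.
  + right; intros t Ht; apply (H (- t)); now rewrite Ropp_involutive.
- intros x t s Gt; rewrite Ropp_plus_distr; now apply Gadd.
- intro x; rewrite Ropp_0; apply phi0.
- intros x t s Gt Gs; rewrite Ropp_plus_distr; now apply phiadd.
Qed.

(** A time [s] missing from the domain would split it into the times before and after [s], against
    connectedness. *)
Lemma flow_interval {X : Type} (dist : X -> X -> R)
  (phi : R -> X -> X) (G : R -> X -> Prop) (x : X) (s t : R) :
  partial_flow dist phi G -> G t x -> 0 <= s <= t -> G s x.
Proof.
intros (_ & _ & G0 & conn & _) Gt Hs.
apply NNPP; intro ns.
assert (s <> 0) by (intros ->; auto).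
assert (s <> t) by (intros ->; auto).
destruct (conn x (fun r => r < s) (fun r => s < r)) as [H1|H1].
- intros r Hr; exists (s - r); split; [lra|].
  intros r' Hr'; apply Rabs_lt_iff in Hr'; lra.
- intros r Hr; exists (r - s); split; [lra|].
  intros r' Hr'; apply Rabs_lt_iff in Hr'; lra.
- intros r Gr; destruct (Rtotal_order r s) as [h|[h|h]]; auto.
  subst; contradiction.
- intros r; lra.
- apply (H1 0); split; [apply G0 | lra].
- apply (H1 t); split; [exact Gt | lra].
Qed.

(** * The unstable part: setting, and orbits over short and long times *)

Section Unstable.

Variables (X : Type) (dist : X -> X -> R) (phi : R -> X -> X) (G : R -> X -> Prop).
(** [K] stands for the truncated distance to the isolated set. The section is applied twice, to the
    flow and to its reversal, with the same [K], [a] and [N]. *)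
Variables (K : X -> R) (a : R) (N : X -> Prop).
Hypothesis metric_dist : is_metric dist.
Hypothesis flow : partial_flow dist phi G.
Hypothesis a_pos : 0 < a.
Hypothesis K_bounds : forall x, 0 <= K x <= 4 * a.
Hypothesis K_lip : forall x y, K x <= K y + dist x y.
Hypothesis K_N : forall x, K x < 4 * a -> N x.
Hypothesis compact_N : compact_in dist N.

Let dist_refl (x : X) : dist x x = 0.
Proof. now apply metric_dist. Qed.
Let dist_sym (x y : X) : dist x y = dist y x.
Proof. now apply metric_dist. Qed.
Let dist_tri (x y z : X) : dist x z <= dist x y + dist y z.
Proof. now apply metric_dist. Qed.
Let dist_pos (x y : X) : 0 <= dist x y.
Proof. generalize (dist_tri x y x) (dist_refl x) (dist_sym x y); lra. Qed.
Let flow_interval' (x : X) (s t : R) : G t x -> 0 <= s <= t -> G s x.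
Proof. now apply (flow_interval dist phi). Qed.

Lemma short_time :
  exists e, 0 < e /\ forall x, N x ->
    forall t, Rabs t < e -> G t x /\ dist x (phi t x) < a.
Proof.
apply (compact_uniform dist N (fun x e =>
  forall t, Rabs t < e -> G t x /\ dist x (phi t x) < a)); auto.
- intros x r r' _ Hr H t Ht; apply H; lra.
- destruct flow as (op & cont & G0 & _ & _ & phi0 & _).
  intros x _.
  destruct (op 0 x (G0 x)) as [r1 [Hr1 H1]].
  destruct (cont 0 x (G0 x) (a / 2) ltac:(lra)) as [r2 [Hr2 H2]].
  rewrite phi0 in H2.
  set (r := Rmin (Rmin r1 r2) (a / 2)).
  assert (r <= r1 /\ r <= r2 /\ r <= a / 2 /\ 0 < r).
  { unfold r; generalize (Rmin_l (Rmin r1 r2) (a / 2)) (Rmin_r (Rmin r1 r2) (a / 2))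
      (Rmin_l r1 r2) (Rmin_r r1 r2) (Rmin_glb_lt _ _ _ Hr1 Hr2).
    intros; repeat split; try lra; apply Rmin_glb_lt; lra. }
  exists r; split; [lra|].
  intros y _ Hy t Ht.
  assert (Gt : G t y) by (apply H1; [rewrite Rminus_0_r|]; lra).
  split; [exact Gt|].
  assert (dist (phi t y) x < a / 2) by (apply H2; auto; [rewrite Rminus_0_r|]; lra).
  generalize (dist_tri y x (phi t y)) (dist_sym x y) (dist_sym x (phi t y)); lra.
Qed.

(** Orbits need not exist for all time, but from a point of [N] they can be continued for a uniform
    time. So an orbit either lives up to [S] or is outside [N] at some time. *)
Lemma stay_or_exit (x : X) (S : R) :
  exists T, 0 <= T /\ G T x /\ (S <= T \/ ~ N (phi T x)).
Proof.
destruct short_time as [e [He short]].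
destruct flow as (_ & _ & G0 & _ & Gadd & _).
assert (Hn : forall n, exists T, 0 <= T /\ G T x /\
    (INR n * (e / 2) <= T \/ ~ N (phi T x))).
{ induction n as [|n [T [HT [GT [IH|IH]]]]].
  - exists 0; simpl; split; [lra|]; split; [apply G0|]; left; lra.
  - destruct (classic (N (phi T x))) as [h|h]; [|exists T; auto].
    exists (e / 2 + T); rewrite S_INR; split; [lra|]; split; [|left; lra].
    apply Gadd; [exact GT|].
    apply short; [exact h|]; apply Rabs_lt_iff; lra.
  - exists T; auto. }
destruct (INR_unbounded (S / (e / 2))) as [n Hs].
destruct (Hn n) as [T [HT [GT H]]].
exists T; split; [exact HT|]; split; [exact GT|].
destruct H as [H|H]; [left | now right].
apply Rlt_le in Hs.
apply (Rmult_le_compat_r (e / 2)) in Hs; [|lra].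
unfold Rdiv in Hs at 1; rewrite Rmult_assoc, Rinv_l in Hs; lra.
Qed.

(** Continuous dependence on the initial point, made uniform over the times in [[0, T]] by
    [interval_uniform]. *)
Lemma orbit_tube (x : X) (T e : R) :
  0 <= T -> G T x -> 0 < e ->
  exists del, 0 < del /\ forall s, 0 <= s <= T -> forall y, dist x y < del ->
    G s y /\ dist (phi s x) (phi s y) < e.
Proof.
intros HT GT He.
destruct flow as (op & cont & _).
apply (interval_uniform T (fun s r => forall y, dist x y < r ->
  G s y /\ dist (phi s x) (phi s y) < e)); auto.
- intros t r r' _ Hr H y Hy; apply H; lra.
- intros t Ht.
  assert (Gt : G t x) by now apply flow_interval' with T.
  destruct (op t x Gt) as [r1 [Hr1 H1]].
  destruct (cont t x Gt (e / 2) ltac:(lra)) as [r2 [Hr2 H2]].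
  exists (Rmin r1 r2); split; [now apply Rmin_glb_lt|].
  intros s Hs Hst y Hy.
  generalize (Rmin_l r1 r2) (Rmin_r r1 r2); intros.
  assert (Gs : G s y) by (apply H1; lra).
  split; [exact Gs|].
  assert (dist (phi s y) (phi t x) < e / 2) by (apply H2; auto; lra).
  assert (dist (phi s x) (phi t x) < e / 2).
  { apply H2; [now apply flow_interval' with T | lra | rewrite dist_refl; lra]. }
  generalize (dist_tri (phi s x) (phi t x) (phi s y)) (dist_sym (phi t x) (phi s y)); lra.
Qed.

(** * Running maxima and eigenfunctions of the flow *)

Definition orbit_max (x : X) (s : R) : R :=
  Rsup (fun v => exists r, 0 <= r <= s /\ v = K (phi r x)).

Lemma orbit_max_ub (x : X) (r s : R) : 0 <= r <= s -> K (phi r x) <= orbit_max x s.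
Proof.
intros Hr; apply Rsup_ub with (4 * a); [|now exists r].
intros w [r' [_ ->]]; apply K_bounds.
Qed.

Lemma orbit_max_le (x : X) (s b : R) :
  0 <= s -> (forall r, 0 <= r <= s -> K (phi r x) <= b) -> orbit_max x s <= b.
Proof.
intros Hs H; apply Rsup_le.
- exists (K (phi 0 x)), 0; split; [lra | reflexivity].
- intros w [r [Hr ->]]; now apply H.
Qed.

(* The cut-off vanishes unless [2 * a < m < 4 * a]: the orbit segment has left the
   region [K <= 2 * a], but it has not left [N]. *)
Definition bump (p : X) (r : R) (z : X) (m : R) : R :=
  Rmax 0 (r - dist p z - Rabs (m - 3 * a)).

Definition term (p : X) (r : R) (x : X) (s : R) : R :=
  exp (- s) * bump p r (phi s x) (orbit_max x s).

Definition eigenfun (p : X) (r : R) (x : X) : R :=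
  Rsup (fun v => exists s, 0 <= s /\ G s x /\ v = term p r x s).

Lemma bump_bounds (p : X) (r : R) (z : X) (m : R) : 0 <= r -> 0 <= bump p r z m <= r.
Proof.
intros Hr; unfold bump; split; [apply Rmax_l|].
apply Rmax_lub; [exact Hr|].
generalize (dist_pos p z) (Rabs_pos (m - 3 * a)); lra.
Qed.

Lemma bump_zero (p : X) (r : R) (z : X) (m : R) :
  r <= a -> m <= 2 * a -> bump p r z m = 0.
Proof.
intros Hr Hm; unfold bump; apply Rmax_left.
generalize (dist_pos p z) (Rle_abs (- (m - 3 * a))); rewrite Rabs_Ropp; lra.
Qed.

Lemma bump_lip (p : X) (r : R) (z z' : X) (m m' : R) :
  bump p r z m <= bump p r z' m' + dist z z' + Rabs (m - m').
Proof.
unfold bump; apply Rmax_lub.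
- generalize (Rmax_l 0 (r - dist p z' - Rabs (m' - 3 * a)))
    (dist_pos z z') (Rabs_pos (m - m')); lra.
- generalize (Rmax_r 0 (r - dist p z' - Rabs (m' - 3 * a))) (dist_tri p z z')
    (Rabs_triang (m - 3 * a) (- (m - m'))); rewrite Rabs_Ropp.
  replace (m - 3 * a + - (m - m')) with (m' - 3 * a) by ring; lra.
Qed.

Lemma exp_neg_bounds (s : R) : 0 <= s -> 0 < exp (- s) <= 1.
Proof.
intros Hs; split; [apply exp_pos|].
rewrite <- exp_0.
destruct (Rle_lt_or_eq_dec 0 s Hs) as [h|<-].
- left; apply exp_increasing; lra.
- rewrite Ropp_0; lra.
Qed.

Lemma term_bounds (p : X) (r : R) (x : X) (s : R) :
  0 <= r -> 0 <= s -> 0 <= term p r x s <= bump p r (phi s x) (orbit_max x s).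
Proof.
intros Hr Hs; unfold term.
generalize (bump_bounds p r (phi s x) (orbit_max x s) Hr) (exp_neg_bounds s Hs).
intros; split; nra.
Qed.

Lemma term_le (p : X) (r : R) (x : X) (s : R) :
  0 <= r -> 0 <= s -> term p r x s <= r.
Proof.
intros Hr Hs; generalize (term_bounds p r x s Hr Hs)
  (bump_bounds p r (phi s x) (orbit_max x s) Hr); lra.
Qed.

Lemma eigenfun_ub (p : X) (r : R) (x : X) (s : R) :
  0 <= r -> 0 <= s -> G s x -> term p r x s <= eigenfun p r x.
Proof.
intros Hr Hs Gs; apply Rsup_ub with r; [|now exists s].
intros w [s' [Hs' [_ ->]]]; now apply term_le.
Qed.

Lemma eigenfun_le (p : X) (r : R) (x : X) (b : R) :
  (forall s, 0 <= s -> G s x -> term p r x s <= b) -> eigenfun p r x <= b.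
Proof.
intros H; apply Rsup_le.
- exists (term p r x 0), 0; split; [lra|]; split; [apply flow | reflexivity].
- intros w [s [Hs [Gs ->]]]; now apply H.
Qed.

Lemma eigenfun_bounds (p : X) (r : R) (x : X) : 0 <= r -> 0 <= eigenfun p r x <= r.
Proof.
intros Hr; split.
- apply Rle_trans with (term p r x 0); [apply term_bounds; lra|].
  apply eigenfun_ub; [exact Hr | lra | apply flow].
- apply eigenfun_le; intros; now apply term_le.
Qed.

(** * Equicontinuity of the eigenfunctions *)

(** Up to time [T] the terms of [y] are close to those of [x], since [bump] is Lipschitz. Later
    terms of [y] are at most [e]: either the factor [exp (- s)] is small, or the running maximum is
    already so near [4 * a] that the cut-off is small. *)
Lemma eigenfun_compare (x y : X) (T S e : R) :
  0 <= T -> 0 < e ->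
  (forall s, 0 <= s <= T -> G s x /\ dist (phi s y) (phi s x) <= e / 2) ->
  (S <= T \/ 4 * a - e / 2 <= K (phi T y)) ->
  a * exp (- S) <= e ->
  forall p r, 0 <= r <= a -> eigenfun p r y <= eigenfun p r x + e.
Proof.
intros HT He near tail HS p r Hr.
apply eigenfun_le; intros s Hs Gs.
generalize (eigenfun_bounds p r x ltac:(lra)); intros Hf.
destruct (Rle_lt_dec s T) as [HsT|HsT].
- destruct (near s ltac:(lra)) as [Gx Hd].
  assert (HM : Rabs (orbit_max y s - orbit_max x s) <= e / 2).
  { apply Rabs_le; split.
    - enough (orbit_max x s <= orbit_max y s + e / 2) by lra.
      apply orbit_max_le; [exact Hs|]; intros u Hu.
      destruct (near u ltac:(lra)) as [_ Hu'].
      generalize (orbit_max_ub y u s Hu) (K_lip (phi u x) (phi u y))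
        (dist_sym (phi u x) (phi u y)); lra.
    - enough (orbit_max y s <= orbit_max x s + e / 2) by lra.
      apply orbit_max_le; [exact Hs|]; intros u Hu.
      destruct (near u ltac:(lra)) as [_ Hu'].
      generalize (orbit_max_ub x u s Hu) (K_lip (phi u y) (phi u x)); lra. }
  apply Rle_trans with (term p r x s + e);
    [|generalize (eigenfun_ub p r x s ltac:(lra) Hs Gx); lra].
  generalize (bump_lip p r (phi s y) (phi s x) (orbit_max y s) (orbit_max x s))
    (exp_neg_bounds s Hs); intros; unfold term; nra.
- enough (term p r y s <= e) by lra.
  destruct tail as [HST|HK].
  + assert (exp (- s) <= exp (- S)) by (left; apply exp_increasing; lra).
    generalize (exp_pos (- s))
      (bump_bounds p r (phi s y) (orbit_max y s) ltac:(lra)); intros.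
    unfold term; nra.
  + apply Rle_trans with (bump p r (phi s y) (orbit_max y s));
      [apply term_bounds; lra|].
    generalize (orbit_max_ub y T s ltac:(lra)) (dist_pos p (phi s y))
      (Rle_abs (orbit_max y s - 3 * a)); intros.
    unfold bump; apply Rmax_lub; lra.
Qed.

(** One [del] serves for all [p] and [r], which makes the supremum over this family continuous. The
    one-sided comparison is applied in both directions, over a time [T] determined by the orbit of
    [x] alone. *)
Lemma eigenfun_equicontinuous (x : X) (e : R) :
  0 < e -> exists del, 0 < del /\ forall y, dist x y < del ->
    forall p r, 0 <= r <= a -> Rabs (eigenfun p r x - eigenfun p r y) <= e.
Proof.
intros He.
(* The time horizon is [S = a / e]: [exp u] exceeds [u], so [exp (- (a / e))] is at most [e / a]. *)
assert (HS : a * exp (- (a / e)) <= e).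
{ rewrite exp_Ropp.
  generalize (exp_pos (a / e)); intros Hp.
  apply Rmult_le_reg_r with (exp (a / e)); [exact Hp|].
  rewrite Rmult_assoc, Rinv_l by lra.
  assert (Hq : 0 < a / e) by now apply Rdiv_lt_0_compat.
  generalize (exp_ineq1 (a / e) ltac:(lra)); intros.
  assert (e * (a / e) = a) by (field; lra).
  nra. }
destruct (stay_or_exit x (a / e)) as [T [HT [GT tail]]].
destruct (orbit_tube x T (e / 2) HT GT ltac:(lra)) as [del [Hdel tube]].
exists del; split; [exact Hdel|].
intros y Hy p r Hr.
assert (tail' : a / e <= T \/ 4 * a <= K (phi T x)).
{ destruct tail as [h|h]; [now left | right].
  apply Rnot_lt_le; intro h'; now apply h, K_N. }
apply Rabs_le; split.
- enough (eigenfun p r y <= eigenfun p r x + e) by lra.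
  apply (eigenfun_compare x y T (a / e)); auto.
  + intros s Hs; split; [now apply flow_interval' with T|].
    rewrite dist_sym; left; now apply tube.
  + destruct tail' as [h|h]; [now left | right].
    destruct (tube T ltac:(lra) y Hy) as [_ Hd].
    generalize (K_lip (phi T x) (phi T y)); lra.
- enough (eigenfun p r x <= eigenfun p r y + e) by lra.
  apply (eigenfun_compare y x T (a / e)); auto.
  + intros s Hs; destruct (tube s Hs y Hy); split; [assumption | lra].
  + destruct tail' as [h|h]; [now left | right; lra].
Qed.

(** * Exponential scaling along the flow *)

(** The term of [phi t x] at time [s] is [exp t] times the term of [x] at time [s + t]. The
    remaining terms of [x], at times up to [t], vanish because the running maximum is still at most
    [2 * a]. *)
Lemma eigenfun_scale (p : X) (r : R) (x : X) (t : R) :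
  0 <= r <= a -> 0 <= t -> G t x ->
  (forall u, 0 <= u <= t -> K (phi u x) <= 2 * a) ->
  eigenfun p r (phi t x) = exp t * eigenfun p r x.
Proof.
intros Hr Ht Gt Hsmall.
destruct flow as (_ & _ & _ & _ & Gadd & _ & phiadd).
assert (Hterm : forall s, 0 <= s -> G s (phi t x) ->
    term p r (phi t x) s = exp t * term p r x (s + t)).
{ intros s Hs Gs; unfold term.
  rewrite <- Rmult_assoc, <- exp_plus.
  replace (t + - (s + t)) with (- s) by ring.
  rewrite phiadd by assumption.
  f_equal.
  assert (Hph : forall u, 0 <= u <= s -> phi u (phi t x) = phi (u + t) x).
  { intros u Hu; apply phiadd; [exact Gt|].
    now apply flow_interval' with s. }
  assert (HM1 : orbit_max (phi t x) s <= orbit_max x (s + t)).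
  { apply orbit_max_le; [exact Hs|]; intros u Hu.
    rewrite Hph by exact Hu; apply orbit_max_ub; lra. }
  (* The two maxima differ by the segment up to [t], where [K] is at most [2 * a]. Hence either both
     cut-offs vanish or the maxima agree. *)
  destruct (Rle_lt_dec (orbit_max x (s + t)) (2 * a)) as [h|h].
  - rewrite !bump_zero; lra.
  - f_equal; apply Rle_antisym; [exact HM1|].
    assert (orbit_max x (s + t) <= Rmax (2 * a) (orbit_max (phi t x) s)) as HM2.
    { apply orbit_max_le; [lra|]; intros u Hu.
      destruct (Rle_lt_dec u t) as [hu|hu].
      - apply Rle_trans with (2 * a); [apply Hsmall; lra | apply Rmax_l].
      - apply Rle_trans with (orbit_max (phi t x) s); [|apply Rmax_r].
        replace u with ((u - t) + t) by ring.
        rewrite <- Hph by lra; apply orbit_max_ub; lra. }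
    revert HM2; apply Rmax_case; lra. }
apply Rle_antisym.
- apply eigenfun_le; intros s Hs Gs.
  rewrite Hterm by assumption.
  apply Rmult_le_compat_l; [left; apply exp_pos|].
  apply eigenfun_ub; [lra | lra | now apply Gadd].
(* For the reverse inequality the factor [exp t] is moved to the other side, so that the supremum
   for [x] stands alone and can be bounded term by term. *)
- apply Rmult_le_reg_l with (exp (- t)); [apply exp_pos|].
  rewrite <- Rmult_assoc, <- exp_plus, Rplus_opp_l, exp_0, Rmult_1_l.
  apply eigenfun_le; intros s Hs Gs.
  generalize (eigenfun_bounds p r (phi t x) ltac:(lra)) (exp_pos (- t)); intros.
  destruct (Rle_lt_dec s t) as [h|h].
  + unfold term; rewrite bump_zero; [nra | lra |].
    apply orbit_max_le; [exact Hs|]; intros; apply Hsmall; lra.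
  + assert (Gs' : G (s - t) (phi t x)).
    { apply Gadd; [exact Gt|]; now replace (s - t + t) with s by ring. }
    generalize (eigenfun_ub p r (phi t x) (s - t) ltac:(lra) ltac:(lra) Gs').
    rewrite Hterm by (assumption || lra).
    replace (s - t + t) with s by ring.
    intros Hle; apply (Rmult_le_compat_l (exp (- t))) in Hle; [|lra].
    rewrite <- Rmult_assoc, <- exp_plus, Rplus_opp_l, exp_0, Rmult_1_l in Hle.
    exact Hle.
Qed.

(** * First hits of the level [K = 3 * a] and separation of points *)

Definition first_hit (x : X) (t : R) : Prop :=
  0 <= t /\ G t x /\ K (phi t x) = 3 * a /\
  forall u, 0 <= u < t -> K (phi u x) < 3 * a.

Lemma orbit_continuous (x : X) (t e : R) :
  G t x -> 0 < e -> exists del, 0 < del /\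
    forall s, G s x -> Rabs (s - t) < del -> dist (phi s x) (phi t x) < e.
Proof.
intros Gt He; destruct flow as (_ & cont & _).
destruct (cont t x Gt e He) as [del [Hdel H]].
exists del; split; [exact Hdel|].
intros s Gs Hs; apply H; auto; rewrite dist_refl; exact Hdel.
Qed.

(** The hitting time is the supremum [c] of the times up to which [K] stays below [3 * a]. By
    continuity, a smaller value at [c] would allow a larger [c], and a larger value would be felt
    before [c]. *)
Lemma first_hit_exists (x : X) (t : R) :
  K x < 3 * a -> 0 <= t -> G t x -> 3 * a <= K (phi t x) ->
  exists s, s <= t /\ first_hit x s.
Proof.
intros Kx Ht Gt Kt.
assert (phi0 : phi 0 x = x) by apply flow.
set (E := fun c => 0 <= c <= t /\ forall u, 0 <= u <= c -> K (phi u x) < 3 * a).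
assert (E0 : E 0).
{ split; [lra|]; intros u Hu; replace u with 0 by lra; now rewrite phi0. }
destruct (completeness E) as [c [cub cleast]].
{ exists t; intros y [Hy _]; lra. }
{ now exists 0. }
assert (Hc : 0 <= c <= t).
{ split; [now apply cub|]; apply cleast; intros y [Hy _]; lra. }
assert (below : forall u, 0 <= u < c -> K (phi u x) < 3 * a).
{ intros u Hu; apply NNPP; intro Hn.
  assert (c <= u); [|lra].
  apply cleast; intros b [Hb Hlt].
  apply Rnot_lt_le; intro; apply Hn, Hlt; lra. }
assert (Gc : G c x) by now apply flow_interval' with t.
exists c; split; [lra|].
split; [lra|]; split; [exact Gc|]; split; [|exact below].
destruct (Rtotal_order (K (phi c x)) (3 * a)) as [h|[h|h]]; [exfalso|exact h|exfalso].
- destruct (orbit_continuous x c (3 * a - K (phi c x)) Gc ltac:(lra)) as [del [Hdel H]].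
  assert (c <> t) by (intros ->; lra).
  set (b := Rmin t (c + del / 2)).
  assert (b <= t /\ b <= c + del / 2 /\ c < b).
  { repeat split; [apply Rmin_l | apply Rmin_r | apply Rmin_glb_lt; lra]. }
  assert (b <= c); [|lra].
  apply cub; split; [lra|]; intros u Hu.
  destruct (Rlt_le_dec u c) as [hu|hu]; [apply below; lra|].
  assert (dist (phi u x) (phi c x) < 3 * a - K (phi c x)).
  { apply H; [apply flow_interval' with t; auto; lra | apply Rabs_lt_iff; lra]. }
  generalize (K_lip (phi u x) (phi c x)); lra.
- destruct (orbit_continuous x c (K (phi c x) - 3 * a) Gc ltac:(lra)) as [del [Hdel H]].
  assert (c <> 0) by (intros ->; rewrite phi0 in h; lra).
  set (u := Rmax 0 (c - del / 2)).
  assert (0 <= u /\ c - del / 2 <= u /\ u < c).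
  { repeat split; [apply Rmax_l | apply Rmax_r | apply Rmax_lub_lt; lra]. }
  assert (dist (phi u x) (phi c x) < K (phi c x) - 3 * a).
  { apply H; [apply flow_interval' with t; auto; lra | apply Rabs_lt_iff; lra]. }
  generalize (K_lip (phi c x) (phi u x)) (below u ltac:(lra))
    (dist_sym (phi c x) (phi u x)); lra.
Qed.

Lemma flow_injective (x y : X) (t : R) :
  G t x -> G t y -> phi t x = phi t y -> x = y.
Proof.
destruct flow as (_ & _ & G0 & _ & Gadd & phi0 & phiadd).
assert (back : forall z, G t z -> phi (- t) (phi t z) = z).
{ intros z Gz; rewrite phiadd; [rewrite Rplus_opp_l; apply phi0 | exact Gz |].
  apply Gadd; [exact Gz|]; rewrite Rplus_opp_l; apply G0. }
intros Gx Gy Heq.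
rewrite <- (back x Gx), Heq; now apply back.
Qed.

(* Take [p = phi t x]: for small [r], a term of [eigenfun p r y] can only reach the
   value [exp (- t) * r] attained by [x] if the orbit of [y] is near [p] at a time not
   much larger than [t], and at that time its running maximum is near [3 * a]. *)
Lemma eigenfun_separates (x y : X) (t : R) :
  first_hit x t -> (forall u, 0 <= u < t -> G u y -> K (phi u y) < 3 * a) ->
  x <> y -> exists p r, 0 <= r <= a /\ eigenfun p r y < eigenfun p r x.
Proof.
intros (Ht & Gx & Kx & below) late Hxy.
(* Before [t] the orbit of [y] stays below [3 * a], hence in [N], so it cannot end before [t]. *)
assert (Gy : G t y).
{ destruct (stay_or_exit y t) as [T [HT [GT tail]]].
  apply flow_interval' with T; [exact GT|]; split; [exact Ht|].
  destruct tail as [h|h]; [exact h|].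
  apply Rnot_lt_le; intro hT; apply h, K_N.
  generalize (late T ltac:(lra) GT); lra. }
assert (Hne : 0 < dist (phi t x) (phi t y)).
{ assert (dist (phi t x) (phi t y) <> 0).
  { intro H; apply Hxy, flow_injective with t; auto; now apply metric_dist. }
  generalize (dist_pos (phi t x) (phi t y)); lra. }
set (r0 := dist (phi t x) (phi t y) / 2).
destruct (orbit_continuous y t r0 Gy ltac:(unfold r0; lra)) as [k [Hk Hnear]].
(* On the compact interval up to [t - k] the orbit of [y] keeps a positive gap [r1] below [3 * a];
   if [t < k], the claim is vacuous. *)
assert (Hr1 : exists r1, 0 < r1 /\
    forall u, 0 <= u -> u <= t - k -> K (phi u y) <= 3 * a - r1).
{ destruct (Rle_lt_dec 0 (t - k)) as [h|h]; [|exists 1; split; [lra | intros; lra]].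
  destruct (interval_uniform (t - k) (fun u e => K (phi u y) <= 3 * a - e) h)
    as [e [He H]].
  - intros; lra.
  - intros u Hu.
    assert (Gu : G u y) by (apply flow_interval' with t; auto; lra).
    assert (Ku : K (phi u y) < 3 * a) by (apply late; auto; lra).
    set (q := (3 * a - K (phi u y)) / 2).
    assert (Hq : 0 < q) by (unfold q; lra).
    destruct (orbit_continuous y u q Gu Hq) as [del [Hdel Hu']].
    exists (Rmin del q); split; [now apply Rmin_glb_lt|].
    intros s Hs Hsu.
    assert (dist (phi s y) (phi u y) < q).
    { apply Hu'; [apply flow_interval' with t; auto; lra|].
      generalize (Rmin_l del q); lra. }
    generalize (K_lip (phi s y) (phi u y)) (Rmin_r del q); unfold q in *; lra.
  - exists e; split; [exact He|]; intros; apply H; lra. }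
destruct Hr1 as [r1 [Hr1 early]].
set (r := Rmin a (Rmin r0 r1)).
assert (Hr : 0 < r /\ r <= a /\ r <= r0 /\ r <= r1).
{ generalize (Rmin_l a (Rmin r0 r1)) (Rmin_r a (Rmin r0 r1)) (Rmin_l r0 r1)
    (Rmin_r r0 r1); unfold r; intros.
  repeat split; try lra.
  repeat apply Rmin_glb_lt; unfold r0; lra. }
exists (phi t x), r; split; [lra|].
assert (HMx : orbit_max x t = 3 * a).
{ apply Rle_antisym.
  - apply orbit_max_le; [exact Ht|]; intros u Hu.
    destruct (Rlt_le_dec u t) as [h|h]; [generalize (below u ltac:(lra)); lra|].
    replace u with t by lra; lra.
  - rewrite <- Kx; apply orbit_max_ub; lra. }
apply Rlt_le_trans with (exp (- t) * r).
- apply Rle_lt_trans with (exp (- (t + k)) * r).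
  + generalize (exp_pos (- (t + k))); intros Hep.
    apply eigenfun_le; intros s Hs Gs.
    (* Three time ranges: from [t + k] on the exponential is smaller; up to [t - k] the maximum is
       too low for the cut-off; in between [phi s y] is farther than [r0] from [phi t x]. *)
    destruct (Rle_lt_dec (t + k) s) as [h|h].
    * assert (exp (- s) <= exp (- (t + k))).
      { destruct h as [h| ->]; [left; apply exp_increasing; lra | lra]. }
      generalize (exp_pos (- s))
        (bump_bounds (phi t x) r (phi s y) (orbit_max y s) ltac:(lra)); intros.
      unfold term; nra.
    * enough (bump (phi t x) r (phi s y) (orbit_max y s) = 0) as Hz
        by (unfold term; rewrite Hz; nra).
      unfold bump; apply Rmax_left.
      generalize (dist_pos (phi t x) (phi s y)) (Rabs_pos (orbit_max y s - 3 * a)).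
      destruct (Rle_lt_dec s (t - k)) as [h'|h']; intros.
      -- assert (orbit_max y s <= 3 * a - r1)
           by (apply orbit_max_le; [exact Hs|]; intros; apply early; lra).
         generalize (Rle_abs (- (orbit_max y s - 3 * a))); rewrite Rabs_Ropp; lra.
      -- assert (dist (phi s y) (phi t y) < r0)
           by (apply Hnear; [exact Gs | apply Rabs_lt_iff; lra]).
         generalize (dist_tri (phi t x) (phi s y) (phi t y)); unfold r0 in *; lra.
  + apply Rmult_lt_compat_r; [lra|]; apply exp_increasing; lra.
- apply Rle_trans with (term (phi t x) r x t); [|apply eigenfun_ub; auto; lra].
  unfold term; rewrite HMx; apply Rmult_le_compat_l; [left; apply exp_pos|].
  unfold bump; rewrite dist_refl, Rminus_diag, Rabs_R0.
  eapply Rle_trans; [|apply Rmax_r]; lra.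
Qed.

(** * The unstable pseudo-metric *)

Definition unstable_dist (x y : X) : R :=
  Rsup (fun v => exists p r, 0 <= r <= a /\
    v = Rabs (eigenfun p r x - eigenfun p r y)).

Lemma unstable_dist_ub (p : X) (r : R) (x y : X) :
  0 <= r <= a -> Rabs (eigenfun p r x - eigenfun p r y) <= unstable_dist x y.
Proof.
intros Hr; apply Rsup_ub with a; [|now exists p, r].
intros w [q [s [Hs ->]]].
generalize (eigenfun_bounds q s x ltac:(lra)) (eigenfun_bounds q s y ltac:(lra)); intros.
apply Rabs_le; lra.
Qed.

Lemma unstable_dist_le (x y : X) (b : R) :
  (forall p r, 0 <= r <= a -> Rabs (eigenfun p r x - eigenfun p r y) <= b) ->
  unstable_dist x y <= b.
Proof.
intros H; apply Rsup_le.
- exists (Rabs (eigenfun x 0 x - eigenfun x 0 y)), x, 0; split; [lra | reflexivity].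
- intros w [p [r [Hr ->]]]; now apply H.
Qed.

Lemma unstable_dist_pos (x y : X) : 0 <= unstable_dist x y.
Proof.
eapply Rle_trans; [apply Rabs_pos|]; apply (unstable_dist_ub x 0 x y); lra.
Qed.

Lemma unstable_dist_sym (x y : X) : unstable_dist x y = unstable_dist y x.
Proof.
apply Rle_antisym; apply unstable_dist_le; intros p r Hr; rewrite Rabs_minus_sym;
  now apply unstable_dist_ub.
Qed.

Lemma unstable_dist_refl (x : X) : unstable_dist x x = 0.
Proof.
apply Rle_antisym; [|apply unstable_dist_pos].
apply unstable_dist_le; intros; rewrite Rminus_diag, Rabs_R0; lra.
Qed.

Lemma unstable_dist_tri (x y z : X) :
  unstable_dist x z <= unstable_dist x y + unstable_dist y z.
Proof.
apply unstable_dist_le; intros p r Hr.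
generalize (unstable_dist_ub p r x y Hr) (unstable_dist_ub p r y z Hr)
  (Rabs_triang (eigenfun p r x - eigenfun p r y) (eigenfun p r y - eigenfun p r z)).
replace (eigenfun p r x - eigenfun p r y + (eigenfun p r y - eigenfun p r z))
  with (eigenfun p r x - eigenfun p r z) by ring; lra.
Qed.

Lemma unstable_dist_continuous (x : X) (e : R) :
  0 < e -> exists del, 0 < del /\ forall y, dist x y < del -> unstable_dist x y < e.
Proof.
intros He; destruct (eigenfun_equicontinuous x (e / 2) ltac:(lra)) as [del [Hdel H]].
exists del; split; [exact Hdel|].
intros y Hy; apply Rle_lt_trans with (e / 2); [|lra].
apply unstable_dist_le; now apply H.
Qed.

Lemma unstable_dist_scale (x y : X) (t : R) :
  0 <= t -> G t x -> G t y ->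
  (forall u, 0 <= u <= t -> K (phi u x) <= 2 * a) ->
  (forall u, 0 <= u <= t -> K (phi u y) <= 2 * a) ->
  unstable_dist (phi t x) (phi t y) = exp t * unstable_dist x y.
Proof.
intros Ht Gx Gy Kx Ky.
assert (Hterm : forall p r, 0 <= r <= a ->
    Rabs (eigenfun p r (phi t x) - eigenfun p r (phi t y)) =
    exp t * Rabs (eigenfun p r x - eigenfun p r y)).
{ intros p r Hr; rewrite !eigenfun_scale by assumption.
  rewrite <- Rmult_minus_distr_l, Rabs_mult, (Rabs_pos_eq (exp t));
    [reflexivity | left; apply exp_pos]. }
apply Rle_antisym.
- apply unstable_dist_le; intros p r Hr; rewrite Hterm by exact Hr.
  apply Rmult_le_compat_l; [left; apply exp_pos | now apply unstable_dist_ub].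
- apply Rmult_le_reg_l with (exp (- t)); [apply exp_pos|].
  rewrite <- Rmult_assoc, <- exp_plus, Rplus_opp_l, exp_0, Rmult_1_l.
  apply unstable_dist_le; intros p r Hr.
  apply Rmult_le_reg_l with (exp t); [apply exp_pos|].
  rewrite <- Hterm, <- Rmult_assoc, <- exp_plus, Rplus_opp_r, exp_0, Rmult_1_l by exact Hr.
  now apply unstable_dist_ub.
Qed.

(** Short orbit pieces move by less than [a], so those starting in [K <= a] remain in [K <= 2 * a],
    where scaling holds. Negative [t] reduces to this by flowing forward from the end points, which
    also lie in [K <= a]. *)
Lemma unstable_dist_flow :
  exists e, 0 < e /\ forall x y t, Rabs t < e ->
    K x <= a -> K y <= a -> K (phi t x) <= a -> K (phi t y) <= a ->
    unstable_dist (phi t x) (phi t y) = exp t * unstable_dist x y.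
Proof.
destruct short_time as [e [He short]].
exists e; split; [exact He|].
assert (small : forall x t, K x <= a -> Rabs t < e -> G t x /\ K (phi t x) <= 2 * a).
{ intros x t Kx Hx.
  destruct (short x (K_N x ltac:(lra)) t Hx) as [Gt Hd].
  split; [exact Gt|].
  generalize (K_lip (phi t x) x) (dist_sym x (phi t x)); lra. }
assert (fwd : forall x y t, Rabs t < e -> K x <= a -> K y <= a -> 0 <= t ->
    unstable_dist (phi t x) (phi t y) = exp t * unstable_dist x y).
{ intros x y t Hte Kx Ky Ht.
  apply Rabs_lt_iff in Hte as Ht'.
  apply unstable_dist_scale; try (apply small; assumption); auto;
    intros u Hu; apply small; auto; apply Rabs_lt_iff; lra. }
intros x y t Hte Kx Ky Kx' Ky'.
destruct (Rle_lt_dec 0 t) as [Ht|Ht]; [now apply fwd|].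
destruct flow as (_ & _ & G0 & _ & Gadd & phi0 & phiadd).
assert (back : forall z, K z <= a -> phi (- t) (phi t z) = z).
{ intros z Kz; destruct (small z t Kz Hte) as [Gz _].
  rewrite phiadd; [rewrite Rplus_opp_l; apply phi0 | exact Gz |].
  apply Gadd; [exact Gz|]; rewrite Rplus_opp_l; apply G0. }
generalize (fwd (phi t x) (phi t y) (- t) ltac:(now rewrite Rabs_Ropp) Kx' Ky' ltac:(lra)).
rewrite !back by assumption; intros ->.
now rewrite <- Rmult_assoc, <- exp_plus, Rplus_opp_r, exp_0, Rmult_1_l.
Qed.

Lemma unstable_dist_exit (x y : X) (t : R) :
  K x <= a -> K y <= a -> 0 <= t -> G t x -> ~ N (phi t x) -> x <> y ->
  0 < unstable_dist x y.
Proof.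
intros Kx Ky Ht Gt Nt Hxy.
assert (Kt : 3 * a <= K (phi t x)).
{ apply Rnot_lt_le; intro h; apply Nt, K_N; lra. }
assert (sep : forall p r, 0 <= r <= a -> eigenfun p r x <> eigenfun p r y ->
    0 < unstable_dist x y).
{ intros p r Hr Hne; eapply Rlt_le_trans; [|apply (unstable_dist_ub p r x y Hr)].
  apply Rabs_pos_lt; lra. }
destruct (first_hit_exists x t ltac:(lra) Ht Gt Kt) as [s [_ hit]].
(* The point whose orbit reaches [3 * a] first plays the leading role in [eigenfun_separates]; in a
   tie it is [x]. *)
destruct (classic (exists u, 0 <= u < s /\ G u y /\ 3 * a <= K (phi u y)))
  as [[u [Hu [Gu Ku]]]|late].
- destruct (first_hit_exists y u ltac:(lra) ltac:(lra) Gu Ku) as [s' [Hs' hit']].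
  destruct (eigenfun_separates y x s' hit') as [p [r [Hr Hlt]]]; auto.
  + intros v Hv _; apply hit; lra.
  + apply (sep p r Hr); lra.
- destruct (eigenfun_separates x y s hit) as [p [r [Hr Hlt]]]; auto.
  + intros v Hv Gv; apply Rnot_le_lt; intro h; apply late; now exists v.
  + apply (sep p r Hr); lra.
Qed.

Lemma unstable_dist_zero (x y : X) :
  (forall t, 0 <= t -> G t x -> K (phi t x) = 0) ->
  (forall t, 0 <= t -> G t y -> K (phi t y) = 0) -> unstable_dist x y = 0.
Proof.
assert (zero : forall z, (forall t, 0 <= t -> G t z -> K (phi t z) = 0) ->
    forall p r, 0 <= r <= a -> eigenfun p r z = 0).
{ intros z Hz p r Hr; apply Rle_antisym; [|apply eigenfun_bounds; lra].
  apply eigenfun_le; intros s Hs Gs.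
  unfold term; rewrite bump_zero; [lra | lra |].
  apply orbit_max_le; [exact Hs|]; intros u Hu.
  rewrite Hz; [lra | lra | now apply flow_interval' with s]. }
intros Hx Hy; apply Rle_antisym; [|apply unstable_dist_pos].
apply unstable_dist_le; intros p r Hr.
rewrite !zero by assumption; rewrite Rminus_diag, Rabs_R0; lra.
Qed.

End Unstable.

(** * Differentiating combinations of exponentials *)

Lemma exp_combination_derivative (A B e : R) :
  0 < e -> exists del, 0 < del /\ forall t, t <> 0 -> Rabs t < del ->
    Rabs ((exp t * A + exp (- t) * B - (A + B)) / t - (A - B)) < e.
Proof.
intros He.
(* The error is [A] and [- B] times the errors of the difference quotients of [exp] at [t] and
   [- t]; the summand 1 keeps [c] positive. *)
set (c := Rabs A + Rabs B + 1).
assert (Hc : 0 < c) by (unfold c; generalize (Rabs_pos A) (Rabs_pos B); lra).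
destruct (derivable_pt_lim_exp 0 (e / c)) as [[del Hdel] H]; [now apply Rdiv_lt_0_compat|].
simpl in H; rewrite exp_0 in H.
exists del; split; [exact Hdel|].
intros t Ht Htd.
assert (H1 := H t Ht Htd).
assert (H2 := H (- t) ltac:(lra) ltac:(now rewrite Rabs_Ropp)).
rewrite Rplus_0_l in H1, H2.
replace ((exp t * A + exp (- t) * B - (A + B)) / t - (A - B)) with
  (A * ((exp t - 1) / t - 1) + - B * ((exp (- t) - 1) / - t - 1)) by (field; lra).
eapply Rle_lt_trans; [apply Rabs_triang|].
rewrite !Rabs_mult, Rabs_Ropp.
set (u := Rabs ((exp t - 1) / t - 1)) in *.
set (v := Rabs ((exp (- t) - 1) / - t - 1)) in *.
assert (Hec : 0 < e / c) by now apply Rdiv_lt_0_compat.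
assert (e = c * (e / c)) by (field; lra).
generalize (Rabs_pos A) (Rabs_pos B); unfold c in *; nra.
Qed.

(** * Distance to a set *)

(** An infimum written as a negated supremum; it is meaningful for nonempty [L], which [l0]
    witnesses below. *)
Definition dist_to {X : Type} (dist : X -> X -> R) (L : X -> Prop) (z : X) : R :=
  - Rsup (fun v => exists l, L l /\ v = - dist l z).

Section DistTo.

Variables (X : Type) (dist : X -> X -> R) (L : X -> Prop) (l0 : X).
Hypothesis metric_dist : is_metric dist.
Hypothesis L_l0 : L l0.

Lemma metric_pos (x y : X) : 0 <= dist x y.
Proof.
destruct metric_dist as [dist0 [dsym tri]].
generalize (tri x y x) (proj2 (dist0 x x) eq_refl) (dsym x y); lra.
Qed.

Lemma dist_to_le (l z : X) : L l -> dist_to dist L z <= dist l z.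
Proof.
intros Ll; unfold dist_to.
enough (- dist l z <= Rsup (fun v => exists l, L l /\ v = - dist l z)) by lra.
apply Rsup_ub with 0; [|now exists l].
intros w [l' [_ ->]]; generalize (metric_pos l' z); lra.
Qed.

Lemma dist_to_ge (z : X) (b : R) : (forall l, L l -> b <= dist l z) -> b <= dist_to dist L z.
Proof.
intros H; unfold dist_to.
enough (Rsup (fun v => exists l, L l /\ v = - dist l z) <= - b) by lra.
apply Rsup_le; [now exists (- dist l0 z), l0|].
intros w [l [Ll ->]]; generalize (H l Ll); lra.
Qed.

Lemma dist_to_pos (z : X) : 0 <= dist_to dist L z.
Proof. apply dist_to_ge; intros; apply metric_pos. Qed.

Lemma dist_to_lip (x y : X) : dist_to dist L x <= dist_to dist L y + dist x y.
Proof.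
enough (dist_to dist L x - dist x y <= dist_to dist L y) by lra.
apply dist_to_ge; intros l Ll.
destruct metric_dist as [_ [dsym tri]].
generalize (dist_to_le l x Ll) (tri l y x) (dsym y x); lra.
Qed.

Lemma dist_to_mem (l : X) : L l -> dist_to dist L l = 0.
Proof.
intros Ll; apply Rle_antisym; [|apply dist_to_pos].
rewrite <- (proj2 (proj1 metric_dist l l) eq_refl); now apply dist_to_le.
Qed.

Lemma dist_to_lt (z : X) (b : R) : dist_to dist L z < b -> exists l, L l /\ dist l z < b.
Proof.
intros H; apply NNPP; intro Hn.
assert (b <= dist_to dist L z); [|lra].
apply dist_to_ge; intros l Ll; apply Rnot_lt_le; intro; apply Hn; now exists l.
Qed.

End DistTo.

(** * Topology of isolated sets *)

(** Each [phi t x] is a limit of points [phi t y] of [L], so it lies in the closed set [N]; an orbit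
    contained in [N] belongs to [L]. *)
Lemma isolated_closed {X : Type} (dist : X -> X -> R)
  (phi : R -> X -> X) (G : R -> X -> Prop) (L N : X -> Prop) (x : X) :
  is_metric dist -> partial_flow dist phi G -> invariant phi G L ->
  isolating_nbhd dist phi G L N ->
  (forall e, 0 < e -> exists y, L y /\ dist x y < e) -> L x.
Proof.
intros metr (op & cont & _) inv (cN & nb & iso) clos.
apply iso; intros t Gt.
apply (compact_closed dist N); auto.
intros e He.
destruct (op t x Gt) as [r1 [Hr1 H1]].
destruct (cont t x Gt e He) as [r2 [Hr2 H2]].
destruct (clos (Rmin r1 r2) ltac:(now apply Rmin_glb_lt)) as [y [Ly Hy]].
assert (Htt : Rabs (t - t) = 0) by (rewrite Rminus_diag; apply Rabs_R0).
generalize (Rmin_l r1 r2) (Rmin_r r1 r2); intros.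
assert (Gy : G t y) by (apply H1; lra).
exists (phi t y); split.
- destruct (nb (phi t y) (inv y Ly t Gy)) as [r [Hr Hn]].
  apply Hn; now rewrite (proj2 (proj1 metr _ _) eq_refl).
- rewrite (proj1 (proj2 metr)); apply H2; auto; lra.
Qed.

(** The radius in [nbhd_of] depends on the point. Compactness of [N] makes it uniform: near a point
    of [L] half its radius works, and near any other point there is no point of [L], as [L] is
    closed. *)
Lemma isolated_uniform_nbhd {X : Type} (dist : X -> X -> R)
  (phi : R -> X -> X) (G : R -> X -> Prop) (L N : X -> Prop) :
  is_metric dist -> partial_flow dist phi G -> invariant phi G L ->
  isolating_nbhd dist phi G L N ->
  exists e, 0 < e /\ forall l z, L l -> dist l z < e -> N z.
Proof.
intros metr fl inv iso.
pose proof iso as (cN & nb & _).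
pose proof metr as (dist0 & dsym & tri).
assert (LN : forall l, L l -> N l).
{ intros l Ll; destruct (nb l Ll) as [r [Hr H]]; apply H.
  now rewrite (proj2 (dist0 l l) eq_refl). }
destruct (compact_uniform dist N
  (fun y e => L y -> forall z, dist y z < e -> N z)) as [e [He H]]; auto.
- intros x r r' _ Hr H Lx z Hz; apply H; auto; lra.
- intros x _.
  destruct (classic (L x)) as [Lx|Lx].
  + destruct (nb x Lx) as [r [Hr H]].
    exists (r / 2); split; [lra|].
    intros y _ Hy _ z Hz; apply H; generalize (tri x y z); lra.
  + apply NNPP; intro Hn; apply Lx.
    apply (isolated_closed dist phi G L N); auto.
    intros e He; apply NNPP; intro Hn'.
    apply Hn; exists e; split; [exact He|].
    intros y _ Hy Ly; exfalso; apply Hn'; now exists y.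
- exists e; split; [exact He|]; intros l z Ll; now apply H; auto.
Qed.

(** The empty set isolates an empty [L], since every orbit contains its point at time 0. This case
    is separate because the distance to [L] requires a point of [L]. *)
Lemma catenary_pseudo_metric_empty {X : Type} (dist : X -> X -> R)
  (phi : R -> X -> X) (G : R -> X -> Prop) (L : X -> Prop) :
  partial_flow dist phi G -> (forall x, ~ L x) ->
  catenary_pseudo_metric dist phi G L (fun _ => False) (fun _ _ => 0).
Proof.
intros fl Hempty.
assert (pf := proj1 (proj2 (proj2 fl))).
repeat split; try tauto.
- intros I U _ _; exists nil; intros x [].
- intros x Lx; destruct (Hempty x Lx).
- intros x H; destruct (H 0 (pf x)).
- intros x y [].
- exists (fun _ _ => 0); intros x y [].
Qed.

(** * Assembling the catenary pseudo-metric *)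

Lemma catenary_pseudo_metric_exists {X : Type} (dist : X -> X -> R)
  (phi : R -> X -> X) (G : R -> X -> Prop) (L : X -> Prop) :
  is_metric dist -> partial_flow dist phi G -> isolated dist phi G L ->
  exists N d, catenary_pseudo_metric dist phi G L N d.
Proof.
intros metr fl [inv [N iso]].
destruct (classic (exists l, L l)) as [[l0 Ll0]|Hempty].
2:{ exists (fun _ => False), (fun _ _ => 0); apply catenary_pseudo_metric_empty; eauto. }
destruct (isolated_uniform_nbhd dist phi G L N) as [e [He nb]]; auto.
pose proof iso as (cN & _ & isoN).
pose proof metr as (dist0 & dsym & tri).
(* With this choice [K z < 4 * a] puts [z] within [e] of a point of [L], hence in [N]. *)
set (a := e / 4).
assert (Ha : 0 < a) by (unfold a; lra).
set (D := dist_to dist L).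
set (K := fun z => Rmin (D z) (4 * a)).
assert (D_pos : forall z, 0 <= D z) by (intro; now apply dist_to_pos with l0).
assert (D_lip : forall x y, D x <= D y + dist x y) by (intros; now apply dist_to_lip with l0).
assert (dist_pos : forall x y, 0 <= dist x y) by now apply metric_pos.
assert (K_bounds : forall z, 0 <= K z <= 4 * a).
{ intro z; split; [apply Rmin_glb; [apply D_pos | lra] | apply Rmin_r]. }
assert (K_lip : forall x y, K x <= K y + dist x y).
{ intros x y; unfold K at 2; pattern (Rmin (D y) (4 * a)); apply Rmin_case.
  - eapply Rle_trans; [apply Rmin_l | apply D_lip].
  - generalize (K_bounds x) (dist_pos x y); lra. }
assert (K_N : forall z, K z < 4 * a -> N z).
{ intros z Hz; unfold K in Hz.
  assert (D z < 4 * a) by (revert Hz; apply Rmin_case; lra).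
  destruct (dist_to_lt X dist L l0 Ll0 z (4 * a) ltac:(assumption)) as [l [Ll Hl]].
  apply (nb l); auto; unfold a in Hl; lra. }
assert (K_L : forall z, L z -> K z = 0).
{ intros z Lz; unfold K, D; rewrite (dist_to_mem X dist L l0) by assumption.
  apply Rmin_left; lra. }
set (phi' := fun t => phi (- t)).
set (G' := fun t => G (- t)).
assert (fl' : partial_flow dist phi' G') by now apply partial_flow_reverse.
set (du := unstable_dist X dist phi G K a).
set (ds := unstable_dist X dist phi' G' K a).
destruct (unstable_dist_flow X dist phi G K a N) as [eu [Heu flow_u]]; auto.
destruct (unstable_dist_flow X dist phi' G' K a N) as [es [Hes flow_s]]; auto.
assert (flow_us : forall x y t, Rabs t < Rmin eu es ->
    K x <= a -> K y <= a -> K (phi t x) <= a -> K (phi t y) <= a ->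
    du (phi t x) (phi t y) = exp t * du x y /\
    ds (phi t x) (phi t y) = exp (- t) * ds x y).
{ intros x y t Ht Kx Ky Kx' Ky'.
  generalize (Rmin_l eu es) (Rmin_r eu es); intros.
  split; [apply flow_u; auto; lra|].
  assert (Hs := flow_s x y (- t)).
  unfold phi' in Hs; rewrite Ropp_involutive, Rabs_Ropp in Hs.
  apply Hs; auto; lra. }
(* The neighborhood shrinks from [N] to [K <= a], where the scaling of [du] and [ds] is available.
   It is a closed subset of [N], so it is compact and still isolating. *)
exists (fun z => K z <= a), (fun x y => du x y + ds x y).
split; [|split; [|split; [|split]]].
- split; [|split].
  + apply (compact_closed_subset dist N); auto; [intros; apply K_N; lra|].
    intros x Hx; exists (K x - a); split; [lra|].
    intros y Hy; generalize (K_lip x y); lra.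
  + intros l Ll; exists a; split; [exact Ha|].
    intros y Hy; generalize (K_lip y l) (dsym y l); rewrite (K_L l Ll); lra.
  + intros x Hx; apply isoN; intros t Gt; apply K_N; generalize (Hx t Gt); lra.
- split; [|split; [|split]].
  + intros x _; unfold du, ds; rewrite !unstable_dist_refl; auto; lra.
  + intros x y _ _.
    assert (0 <= du x y) by now apply unstable_dist_pos.
    assert (0 <= ds x y) by now apply unstable_dist_pos.
    lra.
  + intros x y _ _; f_equal; now apply unstable_dist_sym.
  + intros x y z _ _ _.
    assert (du x z <= du x y + du y z) by now apply unstable_dist_tri.
    assert (ds x z <= ds x y + ds y z) by now apply unstable_dist_tri.
    lra.
- assert (cont : forall x q, 0 < q -> exists del, 0 < del /\ forall y, dist x y < del ->
      du x y < q /\ ds x y < q).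
  { intros x q Hq.
    destruct (unstable_dist_continuous X dist phi G K a N) with (x := x) (e := q)
      as [d1 [Hd1 H1]]; auto.
    destruct (unstable_dist_continuous X dist phi' G' K a N) with (x := x) (e := q)
      as [d2 [Hd2 H2]]; auto.
    exists (Rmin d1 d2); split; [now apply Rmin_glb_lt|].
    intros y Hy; generalize (Rmin_l d1 d2) (Rmin_r d1 d2); intros.
    split; [apply H1 | apply H2]; lra. }
  intros x y _ _ q Hq.
  destruct (cont x (q / 4) ltac:(lra)) as [d1 [Hd1 H1]].
  destruct (cont y (q / 4) ltac:(lra)) as [d2 [Hd2 H2]].
  exists (Rmin d1 d2); split; [now apply Rmin_glb_lt|].
  intros x' y' _ _ Hx Hy.
  generalize (Rmin_l d1 d2) (Rmin_r d1 d2); intros.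
  destruct (H1 x' ltac:(lra)) as [ux sx].
  destruct (H2 y' ltac:(lra)) as [uy sy].
  assert (quad : forall f : X -> X -> R, (forall u v, f u v = f v u) ->
      (forall u v w, f u w <= f u v + f v w) ->
      Rabs (f x' y' - f x y) <= f x x' + f y y').
  { intros f fsym ftri; apply Rabs_le.
    generalize (ftri x' x y') (ftri x y y') (ftri x x' y) (ftri x' y' y)
      (fsym x x') (fsym y y'); lra. }
  assert (Hu := quad du ltac:(now apply unstable_dist_sym) ltac:(now apply unstable_dist_tri)).
  assert (Hs := quad ds ltac:(now apply unstable_dist_sym) ltac:(now apply unstable_dist_tri)).
  replace (du x' y' + ds x' y' - (du x y + ds x y)) with
    (du x' y' - du x y + (ds x' y' - ds x y)) by ring.
  eapply Rle_lt_trans; [apply Rabs_triang|]; lra.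
(* The derivative of [du + ds] is [du - ds], whose derivative is [du + ds] again; the second case
   uses the same estimate with [- ds] as coefficient. *)
- exists (fun x y => du x y - ds x y).
  intros x y Kx Ky; split; intros q Hq.
  + destruct (exp_combination_derivative (du x y) (ds x y) q Hq) as [del [Hdel H]].
    exists (Rmin del (Rmin eu es)); split; [repeat apply Rmin_glb_lt; auto|].
    intros t Ht Htd _ _ Kx' Ky'.
    generalize (Rmin_l del (Rmin eu es)) (Rmin_r del (Rmin eu es)); intros.
    destruct (flow_us x y t ltac:(lra) Kx Ky Kx' Ky') as [-> ->].
    apply H; auto; lra.
  + destruct (exp_combination_derivative (du x y) (- ds x y) q Hq) as [del [Hdel H]].
    exists (Rmin del (Rmin eu es)); split; [repeat apply Rmin_glb_lt; auto|].
    intros t Ht Htd _ _ Kx' Ky'.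
    generalize (Rmin_l del (Rmin eu es)) (Rmin_r del (Rmin eu es)); intros.
    destruct (flow_us x y t ltac:(lra) Kx Ky Kx' Ky') as [-> ->].
    assert (Hlt := H t Ht ltac:(lra)).
    replace (exp t * du x y - exp (- t) * ds x y - (du x y - ds x y)) with
      (exp t * du x y + exp (- t) * - ds x y - (du x y + - ds x y)) by ring.
    replace (du x y + ds x y) with (du x y - - ds x y) by ring; exact Hlt.
- assert (u_pos : forall x y, 0 <= du x y) by now apply unstable_dist_pos.
  assert (s_pos : forall x y, 0 <= ds x y) by now apply unstable_dist_pos.
  assert (sep : forall x y, K x <= a -> K y <= a -> x <> y -> ~ L x ->
      0 < du x y + ds x y).
  { intros x y Kx Ky Hxy nLx.
    (* A point outside [L] leaves [N] at some time, and the sign of that time decides whether [du]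
       or [ds] separates. *)
    assert (Hex : exists t, G t x /\ ~ N (phi t x)).
    { apply NNPP; intro Hn; apply nLx, isoN; intros t Gt.
      apply NNPP; intro; apply Hn; now exists t. }
    destruct Hex as [t [Gt Nt]].
    generalize (u_pos x y) (s_pos x y); intros.
    destruct (Rle_lt_dec 0 t) as [ht|ht].
    - assert (0 < du x y); [|lra].
      apply (unstable_dist_exit X dist phi G K a N) with (t := t); auto.
    - assert (0 < ds x y); [|lra].
      apply (unstable_dist_exit X dist phi' G' K a N) with (t := - t); auto;
        unfold G', phi'; rewrite ?Ropp_involutive; auto; lra. }
  assert (u_sym : forall x y, du x y = du y x) by now apply unstable_dist_sym.
  assert (s_sym : forall x y, ds x y = ds y x) by now apply unstable_dist_sym.
  intros x y Kx Ky; split.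
  + intros Hd; apply NNPP; intro Hn.
    assert (x <> y) by tauto.
    destruct (classic (L x)) as [Lx|nLx].
    * generalize (sep y x Ky Kx ltac:(congruence) ltac:(tauto)) (u_sym x y) (s_sym x y); lra.
    * generalize (sep x y Kx Ky ltac:(assumption) nLx); lra.
  + intros [->|[Lx Ly]].
    * unfold du, ds; rewrite !unstable_dist_refl; auto; lra.
    * unfold du, ds; rewrite !unstable_dist_zero; auto; try lra;
        intros t _ Gt; apply K_L; unfold phi'; apply inv; auto.
Qed.

Theorem mainTheorem8 (X : Type) (dist : X -> X -> R)
  (phi : R -> X -> X) (G : R -> X -> Prop) :
  is_metric dist -> partial_flow dist phi G ->
  forall L : X -> Prop, isolated dist phi G L ->
    (exists N d, catenary_pseudo_metric dist phi G L N d) /\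
    (forall p : X, (forall x, L x <-> x = p) ->
       exists N d, catenary_metric dist phi G L N d).
Proof.
intros metr fl L isoL.
destruct (catenary_pseudo_metric_exists dist phi G L) as [N [d Hd]]; auto.
split; [now exists N, d|].
(* For a singleton the same pseudo-metric is a metric: two points of [L] coincide. *)
intros p Hp; exists N, d; split; [exact Hd|].
destruct Hd as (_ & _ & _ & _ & zero).
intros x y Nx Ny H.
apply zero in H as [H|[Lx Ly]]; auto.
apply Hp in Lx; apply Hp in Ly; congruence.
Qed.
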